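(* Let $n\ge1$ and let $v\in BT_n$ be such that all of the irreducible uniform cover inequalities on $v$ hold with strict inequality; that is, for every non-empty $Y\subset[n]$, every $k\ge1$ and every irreducible $k$-uniform cover $Y_1,\dots,Y_l$ of $Y$ other than the trivial cover consisting of the single set $Y$, one has $\sum_{i=1}^l v_{Y_i}>k\,v_Y$. Then for all large enough $\lambda>0$ we have $\lambda v\in\psi_n$ (i.e. there is $\lambda_0>0$ such that $\lambda v\in\psi_n$ for all $\lambda\ge\lambda_0$).
   Context: Write $[n]=\{1,\dots,n\}$ and let $e_1,\dots,e_n$ be the standard basis of $\mathbb{R}^n$. A body in $\mathbb{R}^n$ is a compact subset $T\subset\mathbb{R}^n$. For non-empty $A\subset[n]$, $T_A$ denotes the orthogonal projection of $T$ onto $\mathrm{Span}(A)=\mathrm{span}\{e_i: i\in A\}$, and $|T_A|$ denotes its $|A|$-dimensional volume (Lebesgue measure in $\mathrm{Span}(A)$). Vectors in $\mathbb{R}^{2^n-1}$ have coordinates indexed by the non-empty subsets of $[n]$. A vector $x\in\mathbb{R}^{2^n-1}$ is constructible if there is a body $T\subset\mathbb{R}^n$ (necessarily with $|T_A|>0$ for all non-empty $A$) such that $x_A=\log|T_A|$ for every non-empty $A\subset[n]$. The constructible region is $\psi_n=\{x\in\mathbb{R}^{2^n-1}: x \text{ is constructible}\}$. For a non-empty $Y\subset[n]$ and an integer $k\ge1$, a $k$-uniform cover of $Y$ is a finite collection (multiset) $Y_1,\dots,Y_l$ of non-empty subsets of $Y$ (not necessarily distinct) such that every element of $Y$ belongs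 to precisely $k$ of the $Y_i$. A cover of $Y$ is uniform if it is $k$-uniform for some $k\ge1$. A uniform cover of $Y$ is irreducible if it cannot be decomposed (as a multiset union) into two smaller uniform covers of $Y$. The set $BT_n\subset\mathbb{R}^{2^n-1}$ is the set of all $x\in\mathbb{R}^{2^n-1}$ such that for every non-empty $Y\subset[n]$, every $k\ge 1$ and every $k$-uniform cover $Y_1,\dots,Y_l$ of $Y$, one has $\sum_{i=1}^l x_{Y_i}\ge k\,x_Y$. *)

(* Defs.v *)
From HB Require Import structures.
From mathcomp Require Import all_boot all_order all_algebra.
From mathcomp Require Import all_classical all_reals all_analysis.

Set Implicit Arguments.
Unset Strict Implicit.
Unset Printing Implicit Defensive.

Import Order.TTheory GRing.Theory Num.Theory.
Import numFieldNormedType.Exports.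

Local Open Scope classical_set_scope.
Local Open Scope ring_scope.

(* [n] is 'I_n and R^n is 'rV[R]_n. *)

Definition nesubset (n : nat) : finType := {A : {set 'I_n} | A != finset.set0}.

Definition coord_vector (R : realType) (n : nat) := {ffun nesubset n -> R^o}.

Section Volume.
Variables (R : realType) (n : nat).
Implicit Types (A : {set 'I_n}) (S : set 'rV[R]_n).

Definition coord_span A : set 'rV[R]_n :=
  [set x | forall i, i \notin A -> x 0 i = 0].

Definition coord_proj A (x : 'rV[R]_n) : 'rV[R]_n :=
  \row_i (if i \in A then x 0 i else 0).

Definition coord_box A (a b : 'rV[R]_n) : set 'rV[R]_n :=
  [set x | coord_span A x /\ forall i, i \in A -> a 0 i <= x 0 i <= b 0 i].

Definition box_volume A (a b : 'rV[R]_n) : R :=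
  \prod_(i in A) (b 0 i - a 0 i).

(* |A|-dimensional Lebesgue (outer) measure in coord_span A: the infimum of
   the total volumes of the countable covers by closed boxes. It agrees with
   Lebesgue measure on every Lebesgue measurable subset of coord_span A, in
   particular on compact ones, the only sets it is applied to below. *)
Definition volume A S : \bar R :=
  ereal_inf [set y : \bar R | exists a b : nat -> 'rV[R]_n,
    [/\ forall j i, i \in A -> a j 0 i <= b j 0 i,
        S `<=` \bigcup_j coord_box A (a j) (b j) &
        y = (\sum_(0 <= j <oo) (box_volume A (a j) (b j))%:E)%E]].

End Volume.

(* lne is the extended logarithm, with lne 0 = -oo and lne +oo = +oo, so the
   equations force every projection of T to have positive finite volume. *)
Definition constructible (R : realType) (n : nat) (x : coord_vector R n) :=
  exists T : set 'rV[R]_n, compact T /\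
    forall A : nesubset n,
      (x A)%:E = lne (volume (val A) (coord_proj (val A) @` T)).

Definition psi (R : realType) (n : nat) : set (coord_vector R n) :=
  [set x | constructible x].

(* A multiset of non-empty subsets of [n] is represented by a sequence listing
   it in some order; two such sequences are identified by perm_eq. *)
Definition kuniform_cover (n k : nat) (Y : nesubset n) (c : seq (nesubset n)) :=
  [/\ (0 < k)%N,
      forall Z, Z \in c -> val Z \subset val Y &
      forall i, i \in val Y -> count (fun Z : nesubset n => i \in val Z) c = k].

Definition uniform_cover (n : nat) (Y : nesubset n) (c : seq (nesubset n)) :=
  exists k, kuniform_cover k Y c.

Definition irreducible_cover (n : nat) (Y : nesubset n)
    (c : seq (nesubset n)) :=
  uniform_cover Y c /\
  ~ exists c1 c2, [/\ uniform_cover Y c1, uniform_cover Y c2 &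
                      perm_eq c (c1 ++ c2)].

Definition BT (R : realType) (n : nat) : set (coord_vector R n) :=
  [set x | forall (Y : nesubset n) (k : nat) (c : seq (nesubset n)),
     kuniform_cover k Y c -> k%:R * x Y <= \sum_(Z <- c) x Z].

(* Main.v *)
(* By linear programming duality, strictness of the irreducible cover
   inequalities yields, for each non-empty B, exponents y_i (i in B) with
   y(B) = v_B and y(C) < v_C for every non-empty C properly contained in B: the
   duals are integral because the constraint matrix is. The box with side
   lengths exp(lambda y_i) in Span(B) then has volume exp(lambda v_B), while its
   projections onto smaller coordinate subspaces are exponentially smaller than
   required. For a union T of pairwise separated such boxes, |T_A| is the sum
   over B containing A of the volumes of the projections to Span(A), and
   rescaling one side of each box by a factor in [0, 1], chosen from the largest
   B downwards, makes all these volumes exactly exp(lambda v_A). *)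
Require Import Defs.
From HB Require Import structures.
From mathcomp Require Import all_boot all_order all_algebra.
From mathcomp Require Import all_classical all_reals all_analysis.
From mathcomp Require Import measurable_realfun.
From mathcomp Require Import zify ring lra.

Set Implicit Arguments.
Unset Strict Implicit.
Unset Printing Implicit Defensive.

Import Order.TTheory GRing.Theory Num.Theory.
Import numFieldNormedType.Exports.

Local Open Scope classical_set_scope.
Local Open Scope ring_scope.

(** * Fourier-Motzkin elimination for strict inequalities with integer coefficients *)

Lemma exists_seq_max (R : realDomainType) (x : R) (s : seq R) :
  exists2 m, m \in x :: s & forall y, y \in x :: s -> y <= m.
Proof.
elim: s x => [|z s IH] x.
  by exists x => [|y]; rewrite !inE // => /eqP->.
have [m ms mge] := IH z.
have [xm|mx] := leP x m.
  exists m => [|y]; first by rewrite in_cons ms orbT.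
  by rewrite in_cons => /predU1P[->//|/mge].
exists x => [|y]; first by rewrite inE eqxx.
by rewrite in_cons => /predU1P[->//|/mge/le_trans]; apply; exact: ltW.
Qed.

(** Take the midpoint of the maximum of [L] and the minimum of [U], the latter being minus the
    maximum of the negated list. If one list is empty, a shift by 1 past the other extremum
    suffices. *)
Lemma exists_seq_between (R : realFieldType) (L U : seq R) :
  (forall l u, l \in L -> u \in U -> l < u) ->
  exists t, (forall l, l \in L -> l < t) /\ (forall u, u \in U -> t < u).
Proof.
case: L U => [|l0 L] [|u0 U] LU; first by exists 0.
- have [m _ mge] := exists_seq_max (- u0) (map -%R U).
  exists (- m - 1); split=> // u uU.
  have := mge (- u); rewrite -(map_cons -%R) map_f // => /(_ isT); lra.
- have [m _ mge] := exists_seq_max l0 L.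
  by exists (m + 1); split=> // l /mge; lra.
- have [m mL mge] := exists_seq_max l0 L.
  have [m' mU mge'] := exists_seq_max (- u0) (map -%R U).
  move: mU; rewrite -(map_cons -%R) => /mapP[u uU m'E].
  have mu := LU _ _ mL uU.
  exists ((m + u) / 2); split=> [l /mge|w wU]; first lra.
  have := mge' (- w); rewrite -(map_cons -%R) map_f // => /(_ isT); lra.
Qed.

Section FourierMotzkin.
Variables (I : finType) (R : realFieldType).
Implicit Types (c d : {ffun I -> int} * R) (y : I -> R).

(** A pair [c] encodes the inequality [\sum_i c.1 i * y i < c.2], which holds at [y] exactly when
    the slack is positive. *)
Definition slack c y : R := c.2 - \sum_i (c.1 i)%:~R * y i.

Lemma slackD c d y : slack (c + d) y = slack c y + slack d y.
Proof.
rewrite /slack /= (eq_bigr (fun i => (c.1 i)%:~R * y i + (d.1 i)%:~R * y i)).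
  by rewrite big_split /=; ring.
by move=> i _; rewrite ffunE intrD mulrDl.
Qed.

Lemma slackMn c y m : slack (c *+ m) y = slack c y *+ m.
Proof.
elim: m => [|m IH]; last by rewrite !mulrS slackD IH.
by rewrite !mulr0n /slack /= big1 ?subr0 // => i _; rewrite ffunE mul0r.
Qed.

Lemma slack_shift c y i t :
  slack c (fun j => if j == i then y j + t else y j) =
  slack c y - (c.1 i)%:~R * t.
Proof.
rewrite /slack (bigD1 i) //= [in RHS](bigD1 i) //= eqxx mulrDr.
under eq_bigr => j /negPf ji do rewrite ji.
by ring.
Qed.

Variable K : {ffun I -> int} * R -> Prop.
Hypothesis K_add : forall c d, K c -> K d -> K (c + d).
Hypothesis K_pos : forall b, K (0, b) -> 0 < b.

Lemma K_muln c m : K c -> (0 < m)%N -> K (c *+ m).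
Proof.
move=> Kc; elim: m => [//|[|m] IH] _; first by rewrite mulr1n.
by rewrite mulrS; apply: K_add => //; exact: IH.
Qed.

(** Induction on the list [s] of variables that may still occur. [K] plays the role of the derivable
    inequalities: since coefficients are integers, elimination needs only closure under addition,
    and [K_pos] excludes contradictions once no variable is left. *)
Lemma fourier_motzkin_supp (s : seq I) (S : seq ({ffun I -> int} * R)) :
  (forall c, c \in S -> K c) ->
  (forall c i, c \in S -> i \notin s -> c.1 i = 0) ->
  exists y, forall c, c \in S -> 0 < slack c y.
Proof.
elim: s S => [|i s IH] S KS supp.
  exists (fun=> 0) => c cS.
  have c0 : c.1 = 0 by apply/ffunP => i; rewrite ffunE supp.
  rewrite /slack big1 ?subr0 => [|i _]; last by rewrite mulr0.
  by apply: K_pos; rewrite -c0 -surjective_pairing; exact: KS.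
(* For [c.1 i > 0 > d.1 i] this positive integer combination cancels the variable [i]. *)
pose comb c d : {ffun I -> int} * R := c *+ `|d.1 i|%N + d *+ `|c.1 i|%N.
pose S0 := [seq c : {ffun I -> int} * R <- S | c.1 i == 0].
pose SP := [seq c : {ffun I -> int} * R <- S | 0 < c.1 i].
pose SN := [seq c : {ffun I -> int} * R <- S | c.1 i < 0].
have [] := IH (S0 ++ [seq comb c d | c <- SP, d <- SN]).
- move=> c; rewrite mem_cat => /orP[|/allpairsP[[a b] /= [+ + ->]]].
    by rewrite mem_filter => /andP[_ /KS].
  rewrite !mem_filter => /andP[a0 aS] /andP[b0 bS].
  by apply: K_add; (apply: K_muln; [exact: KS|lia]).
- move=> c j; rewrite mem_cat => /orP[|/allpairsP[[a b] /= [+ + ->]]].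
    rewrite mem_filter => /andP[/eqP c0 cS] js.
    by have [->//|ji] := eqVneq j i; apply: supp; rewrite // inE negb_or ji.
  rewrite !mem_filter => /andP[a0 aS] /andP[b0 bS] js.
  have E (c' : {ffun I -> int} * R) m : (c' *+ m).1 j = c'.1 j *+ m.
    by elim: m => [|m IHm]; rewrite ?mulr0n ?ffunE // !mulrS -IHm ffunE.
  rewrite ffunE !E; have [->|ji] := eqVneq j i; last first.
    have jis : j \notin i :: s by rewrite inE negb_or ji.
    by rewrite (supp a j) // (supp b j) // !mul0rn addr0.
  rewrite -[a.1 i *+ _]mulr_natr -[b.1 i *+ _]mulr_natr !natz !abszE.
  by rewrite (gtr0_norm a0) (ltr0_norm b0); ring.
move=> y Hy.
have HPN c d : c \in SP -> d \in SN ->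
    slack d y / (d.1 i)%:~R < slack c y / (c.1 i)%:~R.
  move=> cP dN; have := Hy (comb c d).
  rewrite mem_cat allpairs_f ?orbT // => /(_ isT).
  move: cP dN; rewrite !mem_filter => /andP[c0 _] /andP[d0 _].
  rewrite slackD !slackMn.
  rewrite -[slack c y *+ _]mulr_natr -[slack d y *+ _]mulr_natr.
  rewrite !natr_absz.
  rewrite (ltr0_norm d0) (gtr0_norm c0) rmorphN /=.
  have cR : 0 < (c.1 i)%:~R :> R by rewrite ltr0z.
  have dR : (d.1 i)%:~R < 0 :> R by rewrite ltrz0.
  rewrite ltr_pdivlMr // mulrAC ltr_ndivrMr //; lra.
have [|t [tL tU]] := @exists_seq_between R
    [seq slack c y / (c.1 i)%:~R | c <- SN]
    [seq slack c y / (c.1 i)%:~R | c <- SP].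
  by move=> _ _ /mapP[d dN ->] /mapP[c cP ->]; exact: HPN.
(* The slacks were evaluated with the old value [y i] included, so [t] is an increment of that
   coordinate, not its new value. *)
exists (fun j => if j == i then y j + t else y j) => c cS.
rewrite slack_shift subr_gt0.
have [c0|c0|c0] := ltgtP (c.1 i) 0.
- have cN : c \in SN by rewrite mem_filter c0.
  have := tL _ (map_f (fun d : {ffun I -> int} * R => slack d y / (d.1 i)%:~R) cN).
  by rewrite ltr_ndivrMr ?ltrz0 // mulrC.
- have cP : c \in SP by rewrite mem_filter c0.
  have := tU _ (map_f (fun d : {ffun I -> int} * R => slack d y / (d.1 i)%:~R) cP).
  by rewrite ltr_pdivlMr ?ltr0z // mulrC.
- by rewrite c0 mul0r Hy // mem_cat mem_filter c0 eqxx cS.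
Qed.

Lemma fourier_motzkin (S : seq ({ffun I -> int} * R)) :
  (forall c, c \in S -> K c) -> exists y, forall c, c \in S -> 0 < slack c y.
Proof.
move=> KS; apply: (@fourier_motzkin_supp (enum I)) => // c i _.
by rewrite mem_enum.
Qed.

End FourierMotzkin.

(** * Uniform covers and the exponents of the boxes *)

Lemma uniform_cover_size_gt0 (n k : nat) (Y : nesubset n) (c : seq (nesubset n)) :
  kuniform_cover k Y c -> (0 < size c)%N.
Proof.
case=> k0 _ H; case/set0Pn: (valP Y) => i /H <- in k0 *.
by apply: leq_trans k0 (count_size _ _).
Qed.

(** Strong induction on the size: a reducible cover splits into two strictly smaller uniform covers
    whose multiplicities add up, and the two strict inequalities are summed. The condition
    [Y \notin c] rules out the trivial cover and passes to both pieces. *)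
Lemma uniform_cover_lt (R : realType) (n : nat) (v : coord_vector R n)
    (Y : nesubset n) :
  (forall (k : nat) (c : seq (nesubset n)),
     kuniform_cover k Y c -> irreducible_cover Y c -> c <> [:: Y] ->
     k%:R * v Y < \sum_(Z <- c) v Z) ->
  forall (k : nat) (c : seq (nesubset n)),
    kuniform_cover k Y c -> Y \notin c -> k%:R * v Y < \sum_(Z <- c) v Z.
Proof.
move=> strict k c; have [m] := ubnP (size c); elim: m => // m IH in k c *.
rewrite ltnS => cm kc Yc.
have [irr|] := pselect (irreducible_cover Y c).
  by apply: strict => // cE; rewrite cE inE eqxx in Yc.
move=> /not_andP[[]|/contrapT]; first by exists k.
move=> [c1 [c2 [[k1 kc1] [k2 kc2] pc]]].
have kE : k = (k1 + k2)%N.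
  case/set0Pn: (valP Y) => i iY.
  case: (kc1) (kc2) (kc) => [_ _ /(_ i iY)<-] [_ _ /(_ i iY)<-] [_ _ /(_ i iY)<-].
  by rewrite (permP pc) count_cat.
have := perm_size pc; rewrite size_cat => sc.
have s1 := uniform_cover_size_gt0 kc1; have s2 := uniform_cover_size_gt0 kc2.
move: Yc; rewrite (perm_mem pc) mem_cat negb_or => /andP[Y1 Y2].
have h1 : k1%:R * v Y < \sum_(Z <- c1) v Z.
  by apply: IH => //; apply: leq_trans cm; rewrite sc -[ltnLHS]addn0 ltn_add2l.
have h2 : k2%:R * v Y < \sum_(Z <- c2) v Z.
  by apply: IH => //; apply: leq_trans cm; rewrite sc -[ltnLHS]add0n ltn_add2r.
by rewrite (perm_big _ pc) big_cat /= kE natrD mulrDl ltrD.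
Qed.

(* The dual certificates of infeasibility of the system
   [y(C) < v C] (C a proper subset of Y), [y(Y) > v Y]
   are the uniform covers of Y by proper subsets that violate [v]. *)
Lemma exists_box_exponents (R : realType) (n : nat) (v : coord_vector R n)
    (Y : nesubset n) :
  (forall (k : nat) (c : seq (nesubset n)),
     kuniform_cover k Y c -> Y \notin c -> k%:R * v Y < \sum_(Z <- c) v Z) ->
  exists y : 'I_n -> R, \sum_(i in val Y) y i = v Y /\
    forall C : nesubset n, val C \proper val Y -> \sum_(i in val C) y i < v C.
Proof.
move=> cover_lt.
pose row (C : nesubset n) : {ffun 'I_n -> int} := [ffun i => (i \in val C)%:Z].
(* Non-negative integer combinations of the constraints: that of [Z] once per occurrence in [c],
   that of [Y] [k] times. The size condition excludes the empty combination. *)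
pose K (a : {ffun 'I_n -> int} * R) := exists (c : seq (nesubset n)) (k : nat),
  [/\ (0 < size c + k)%N, forall Z, Z \in c -> val Z \proper val Y,
      forall i, a.1 i = (count (fun Z : nesubset n => i \in val Z) c)%:Z
                        - (k * (i \in val Y))%:Z &
      a.2 = \sum_(Z <- c) v Z - k%:R * v Y].
have K_add a b : K a -> K b -> K (a + b).
  move=> [c [k [c0 cY aE a2]]] [d [l [d0 dY bE b2]]].
  exists (c ++ d), (k + l)%N; split.
  - by rewrite size_cat; lia.
  - by move=> Z; rewrite mem_cat => /orP[/cY|/dY].
  - by move=> i; rewrite ffunE aE bE count_cat mulnDl; lia.
  - by rewrite /= a2 b2 big_cat natrD /=; ring.
have K_pos b : K (0, b) -> 0 < b.
  move=> [c [k [c0 cY /= aE ->]]]; rewrite subr_gt0.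
  have E i : count (fun Z : nesubset n => i \in val Z) c = (k * (i \in val Y))%N.
    by have /esym/eqP := aE i; rewrite ffunE subr_eq0 => /eqP[].
  apply: cover_lt; last first.
    by apply/negP => /cY; rewrite properE subxx andbF.
  split=> [|Z /cY/proper_sub//|i iY]; last by rewrite E iY muln1.
  (* It remains to see that [0 < k]: with [k = 0] no point would be counted, yet any [Z] in [c] is
     non-empty. *)
  case: c c0 {cY aE} E => [|Z c]; first by rewrite add0n.
  move=> _ E; case: k E => // E.
  case/set0Pn: (valP Z) => i iZ; have := E i.
  by rewrite /= [i \in _]iZ mul0n.
pose S := (- row Y, - v Y) ::
  [seq (row C, v C) | C in [pred C : nesubset n | val C \proper val Y]].
have KS a : a \in S -> K a.
  rewrite inE => /predU1P[->|].
    exists [::], 1%N; split=> // [i|].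
      by rewrite !ffunE /= mul1n sub0r.
    by rewrite /= big_nil mul1r sub0r.
  case/mapP => C; rewrite mem_enum inE => CY ->.
  exists [:: C], 0%N; split=> // [Z|i|].
  - by rewrite inE => /eqP->.
  - by rewrite ffunE /= mul0n addn0 subr0.
  - by rewrite /= big_seq1 mul0r subr0.
have [y Hy] := fourier_motzkin K_add K_pos KS.
have rowE (C : nesubset n) :
    \sum_i (row C i)%:~R * y i = \sum_(i in val C) y i.
  rewrite [RHS]big_mkcond; apply: eq_bigr => i _; rewrite ffunE.
  by case: (i \in val C); rewrite ?mul1r ?mul0r.
have yY : v Y < \sum_(i in val Y) y i.
  have := Hy (- row Y, - v Y); rewrite mem_head => /(_ isT).
  rewrite /slack /= (eq_bigr (fun i => - ((row Y i)%:~R * y i))).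
    by rewrite sumrN rowE; lra.
  by move=> i _; rewrite ffunE rmorphN mulNr.
have yC (C : nesubset n) : val C \proper val Y -> \sum_(i in val C) y i < v C.
  move=> CY; have := Hy (row C, v C); rewrite inE map_f ?orbT.
    by move=> /(_ isT); rewrite /slack /= rowE subr_gt0.
  by rewrite mem_enum inE.
case/set0Pn: (valP Y) => j jY.
(* The positive excess over [v Y] is removed at a single coordinate, which can only lower the sums
   over proper subsets. *)
pose e := \sum_(i in val Y) y i - v Y.
exists (fun i => y i - (if i == j then e else 0)); split=> [|C CY].
  rewrite sumrB -[X in _ - X]big_mkcondr (@big_pred1 _ _ _ _ j) /e ?subKr //.
  by move=> i; rewrite /= andb_idl // => /eqP->.
apply: le_lt_trans (yC C CY); apply: ler_sum => i _.
by rewrite gerBl; case: eqP => // _; rewrite subr_ge0 ltW.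
Qed.

(** * Volumes of finite unions of disjoint boxes *)

Section BoxVolume.
Variable R : realType.

Lemma measurable_indic_itv (k a b : R) :
  measurable_fun [set: R] (fun t : R => (k * \1_`[a, b] t)%:E).
Proof.
apply/measurable_EFinP/measurable_funM; first exact: measurable_cst.
by apply: measurable_indic; exact: measurable_itv.
Qed.

Lemma integral_indic_itv (k a b : R) : 0 <= k -> a <= b ->
  (\int[@lebesgue_measure R]_t (k * \1_`[a, b] t)%:E = (k * (b - a))%:E)%E.
Proof.
move=> k0 ab; under eq_integral do rewrite EFinM.
rewrite ge0_integralZl_EFin //; last first.
  by apply/measurable_EFinP/measurable_indic; exact: measurable_itv.
rewrite integral_indic //.
rewrite setIT [X in (_ * X)%E](_ : _ = (b - a)%:E) ?EFinM //.
rewrite [LHS](lebesgue_measure_itv `[a, b]) /= lte_fin.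
by case: ltgtP ab => // -> _; rewrite subrr.
Qed.

(* Integrates the pointwise inequality one coordinate at a time. *)
Lemma sum_volume_le (I : eqType) (s : seq I) (J : Type) (r : seq J)
    (c : J -> R) (p q : J -> I -> R) (d : nat -> R) (a b : nat -> I -> R) :
  uniq s -> (forall j, 0 <= c j) -> (forall j, 0 <= d j) ->
  (forall j i, i \in s -> p j i <= q j i) ->
  (forall j i, i \in s -> a j i <= b j i) ->
  (forall x : I -> R,
    (\sum_(j <- r) (c j * \prod_(i <- s) \1_`[p j i, q j i] (x i))%:E <=
     \sum_(0 <= j <oo) (d j * \prod_(i <- s) \1_`[a j i, b j i] (x i))%:E)%E) ->
  (\sum_(j <- r) (c j * \prod_(i <- s) (q j i - p j i))%:E <=
   \sum_(0 <= j <oo) (d j * \prod_(i <- s) (b j i - a j i))%:E)%E.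
Proof.
elim: s c d => [|i s IH] c d /=.
  move=> _ _ _ _ _ /(_ (fun=> 0)).
  under eq_bigr do rewrite big_nil.
  under [leRHS]eq_eseriesr do rewrite big_nil.
  under [X in _ -> (X <= _)%E]eq_bigr do rewrite big_nil.
  by under [X in _ -> (_ <= X)%E]eq_eseriesr do rewrite big_nil.
move=> /andP[i_s us] c0 d0 pq ab H.
under eq_bigr do rewrite big_cons mulrA.
under eq_eseriesr do rewrite big_cons mulrA.
have pqi j : p j i <= q j i by apply: pq; rewrite mem_head.
have abi j : a j i <= b j i by apply: ab; rewrite mem_head.
(* The side lengths in direction [i] are absorbed into the weights [c] and [d]. *)
apply: IH => //.
- by move=> j; rewrite mulr_ge0 // subr_ge0.
- by move=> j; rewrite mulr_ge0 // subr_ge0.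
- by move=> j k ks; apply: pq; rewrite inE ks orbT.
- by move=> j k ks; apply: ab; rewrite inE ks orbT.
move=> x.
(* With the other coordinates frozen at [x], [H] is an inequality between functions of coordinate
   [i] alone. It is integrated over that coordinate, exchanging integral and series by
   non-negativity. *)
pose P j := \prod_(k <- s) (\1_`[p j k, q j k] (x k) : R).
pose Q j := \prod_(k <- s) (\1_`[a j k, b j k] (x k) : R).
have P0 j : 0 <= c j * P j by rewrite mulr_ge0 // prodr_ge0.
have Q0 j : 0 <= d j * Q j by rewrite mulr_ge0 // prodr_ge0.
have Hx t : (\sum_(j <- r) (c j * P j * \1_`[p j i, q j i] t)%:E <=
    \sum_(0 <= j <oo) (d j * Q j * \1_`[a j i, b j i] t)%:E)%E.
  have E (e : R) (l u : I -> R) :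
      e * \prod_(k <- i :: s)
            \1_`[l k, u k] (if k == i then t else x k) =
      e * (\prod_(k <- s) \1_`[l k, u k] (x k)) * \1_`[l i, u i] t.
    rewrite big_cons eqxx mulrCA mulrC; congr (_ * _ * _).
    apply: eq_big_seq => k ks; case: eqP => // ki.
    by rewrite -ki ks in i_s.
  have := H (fun k => if k == i then t else x k).
  under eq_bigr do rewrite E.
  by under eq_eseriesr do rewrite E.
have m1 j : measurable_fun [set: R]
    (fun t : R => (c j * P j * \1_`[p j i, q j i] t)%:E).
  exact: measurable_indic_itv.
have m2 j : measurable_fun [set: R]
    (fun t : R => (d j * Q j * \1_`[a j i, b j i] t)%:E).
  exact: measurable_indic_itv.
have z1 j (t : R) : [set: R] t -> (0 <= (c j * P j * \1_`[p j i, q j i] t)%:E)%E.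
  by move=> _; rewrite lee_fin mulr_ge0.
have z2 j (t : R) : [set: R] t -> (0 <= (d j * Q j * \1_`[a j i, b j i] t)%:E)%E.
  by move=> _; rewrite lee_fin mulr_ge0.
have E1 : (\int[@lebesgue_measure R]_t
      (\sum_(j <- r) (c j * P j * \1_`[p j i, q j i] t)%:E) =
    \sum_(j <- r) (c j * (q j i - p j i) * P j)%:E)%E.
  transitivity (\sum_(j <- r) \int[@lebesgue_measure R]_t
      (c j * P j * \1_`[p j i, q j i] t)%:E)%E.
    exact: (ge0_integral_sum (@lebesgue_measure R) measurableT m1 z1 r).
  by apply: eq_bigr => j _; rewrite integral_indic_itv // mulrAC.
have E2 : (\int[@lebesgue_measure R]_t
      (\sum_(0 <= j <oo) (d j * Q j * \1_`[a j i, b j i] t)%:E) =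
    \sum_(0 <= j <oo) (d j * (b j i - a j i) * Q j)%:E)%E.
  transitivity (\sum_(0 <= j <oo) \int[@lebesgue_measure R]_t
      (d j * Q j * \1_`[a j i, b j i] t)%:E)%E.
    exact: (integral_nneseries (@lebesgue_measure R) measurableT m2 z2).
  by apply: eq_eseriesr => j _; rewrite integral_indic_itv // mulrAC.
rewrite -E1 -E2; apply: ge0_le_integral => //.
- move=> t _.
  by rewrite sumEFin lee_fin sumr_ge0 // => j _; rewrite mulr_ge0.
- by apply: emeasurable_sum => j; exact: m1.
- by apply: ge0_emeasurable_sum => [j t Dt _|j _]; [exact: z2|exact: m2].
Qed.

Lemma prod_indic (I : eqType) (s : seq I) (l u x : I -> R) :
  \prod_(i <- s) (\1_`[l i, u i] (x i) : R) =
  (all (fun i => l i <= x i <= u i) s)%:R.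
Proof.
elim: s => [|i s IH]; first by rewrite big_nil.
rewrite big_cons IH /= indicE mem_setE in_itv /=.
by case: (l i <= x i <= u i); rewrite ?mul1r ?mul0r.
Qed.

Variable n : nat.
Implicit Types (A : {set 'I_n}) (a b : 'rV[R]_n) (S : set 'rV[R]_n).

Lemma compact_coord_box a b : compact (coord_box [set: 'I_n] a b).
Proof.
have -> : coord_box [set: 'I_n] a b =
    [set x : 'rV[R]_n | forall i, [set` `[a 0 i, b 0 i]] (x ord0 i)].
  apply/seteqP; split=> x /=.
    by case=> _ H i; rewrite in_itv /=; apply: H; rewrite inE.
  by move=> H; split=> i; [rewrite inE|move=> _; have := H i; rewrite in_itv].
apply: (@rV_compact _ _ (fun i => [set` `[a 0 i, b 0 i]])) => i.
exact: segment_compact.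
Qed.

Lemma coord_proj_box A a b : (forall i, a 0 i <= b 0 i) ->
  coord_proj A @` coord_box [set: 'I_n] a b = coord_box A a b.
Proof.
move=> ab; apply/seteqP; split=> [_ [x [_ abx] <-]|x [xA abx]] /=.
  by split=> i iA; rewrite mxE; [rewrite (negPf iA)|rewrite iA abx ?inE].
exists (\row_i (if i \in A then x 0 i else a 0 i)).
  split=> i; first by rewrite inE.
  by move=> _; rewrite mxE; case: ifPn => [/abx//|_]; rewrite lexx ab.
by apply/rowP => i; rewrite !mxE; case: ifPn => iA; [rewrite iA|rewrite xA].
Qed.

Lemma box_volume_ge0 A a b :
  (forall i, i \in A -> a 0 i <= b 0 i) -> 0 <= box_volume A a b.
Proof. by move=> ab; apply: prodr_ge0 => i /ab; rewrite subr_ge0. Qed.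

(** The finite family becomes a sequence, as [volume] demands, by padding with boxes degenerate to
    the origin; these have volume 0 because [A] is non-empty. *)
Lemma volume_le_sum (J : finType) A (a b : J -> 'rV[R]_n) S :
  A != finset.set0 -> (forall j i, i \in A -> a j 0 i <= b j 0 i) ->
  S `<=` \bigcup_j coord_box A (a j) (b j) ->
  (volume A S <= (\sum_j box_volume A (a j) (b j))%:E)%E.
Proof.
move=> A0 ab SJ.
pose ext (f : J -> 'rV[R]_n) k := oapp f 0 (ohead (drop k (enum J))).
have extE f (j : J) : ext f (index j (enum J)) = f j.
  by rewrite /ext (drop_nth j) ?index_mem ?mem_enum //= nth_index ?mem_enum.
have ext0 f k : (size (enum J) <= k)%N -> ext f k = 0.
  by move=> h; rewrite /ext drop_oversize.
apply: ereal_inf_lbound; exists (ext a), (ext b); split.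
- move=> k i iA; rewrite /ext; case: ohead => [j|] /=; last by rewrite lexx.
  exact: ab.
- move=> x /SJ[j _ xj]; exists (index j (enum J)) => //.
  by rewrite !extE.
rewrite (@nneseries_split _ _ _ #|J|); last first.
  move=> k _; rewrite lee_fin box_volume_ge0 // => i iA.
  rewrite /ext; case: ohead => [j|] /=; last by rewrite lexx.
  exact: ab.
rewrite eseries0 ?adde0; last first.
  move=> k; rewrite add0n cardE => h _; case/set0Pn: A0 => i iA.
  by rewrite !ext0 // /box_volume (bigD1 i) //= subrr mul0r.
rewrite add0n sumEFin; congr (_%:E).
rewrite cardE -[LHS]big_enum /=.
case E : (enum J) => [|j0 s]; first by rewrite !big_nil.
rewrite (big_nth j0) -E; apply: eq_big_nat => k /andP[_ kJ].
by rewrite -(extE a (nth j0 _ k)) -(extE b (nth j0 _ k)) index_uniq ?enum_uniq.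
Qed.

(** For any countable cover of [S], disjointness bounds the sum of the indicators of the inner boxes
    by the sum of those of the covering boxes; [sum_volume_le] integrates this to volumes. *)
Lemma sum_le_volume (J : finType) A (a b : J -> 'rV[R]_n) S (P : pred J) :
  (forall j i, i \in A -> a j 0 i <= b j 0 i) ->
  (forall j, P j -> coord_box A (a j) (b j) `<=` S) ->
  (forall j k x, P j -> P k -> coord_box A (a j) (b j) x ->
    coord_box A (a k) (b k) x -> j = k) ->
  ((\sum_(j | P j) box_volume A (a j) (b j))%:E <= volume A S)%E.
Proof.
move=> ab JS disj; apply: le_ereal_inf_tmp => _ [a' [b' [ab' SJ ->]]].
have := @sum_volume_le 'I_n (enum A) J (enum P) (fun=> 1)
  (fun j i => a j 0 i) (fun j i => b j 0 i) (fun=> 1)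
  (fun j i => a' j 0 i) (fun j i => b' j 0 i).
have E (u w : 'rV[R]_n) :
    1 * \prod_(i <- enum A) (w 0 i - u 0 i) = box_volume A u w.
  by rewrite mul1r big_enum.
under eq_bigr do rewrite E.
under [X in _ -> _ -> _ -> _ -> _ -> _ -> (_ <= X)%E]eq_eseriesr do rewrite E.
rewrite sumEFin big_enum /=; apply; rewrite ?enum_uniq //.
- by move=> j i; rewrite mem_enum; exact: ab.
- by move=> j i; rewrite mem_enum; exact: ab'.
move=> x.
(* Extension by 0 outside [A] puts the point in [coord_span A], so the product of interval
   indicators is box membership of [z]. *)
pose z : 'rV[R]_n := \row_i (if i \in A then x i else 0).
have indE (u w : 'rV[R]_n) :
    1 * \prod_(i <- enum A) (\1_`[u 0 i, w 0 i] (x i) : R) =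
    `[< coord_box A u w z >]%:R.
  rewrite mul1r prod_indic; congr (nat_of_bool _)%:R.
  apply/allP/asboolP => [H|[_ H] i].
    split=> i iA; first by rewrite mxE (negPf iA).
    by rewrite mxE iA; apply: H; rewrite mem_enum.
  by rewrite mem_enum => iA; have := H i iA; rewrite mxE iA.
under eq_bigr do rewrite indE.
under eq_eseriesr do rewrite indE.
have ge0 k : (0 <= (`[< coord_box A (a' k) (b' k) z >]%:R)%:E :> \bar R)%E.
  by rewrite lee_fin.
have [[j Pj zj]|none] := pselect (exists2 j, P j & coord_box A (a j) (b j) z).
  have [k _ zk] := SJ _ (JS j Pj _ zj).
  rewrite big_enum /= (bigD1 j) //= (asboolT zj) big1 ?adde0; last first.
    move=> j' /andP[Pj' /eqP j'j]; rewrite asboolF // => zj'.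
    by apply: j'j; exact: disj zj' zj.
  apply: le_trans (nneseries_lim_ge k.+1 _); last by move=> ? _ _; exact: ge0.
  rewrite big_nat_recr //= (asboolT zk) leeDr //.
  by apply: sume_ge0 => *; exact: ge0.
rewrite big_enum /= big1; last first.
  by move=> j Pj; rewrite asboolF // => zj; apply: none; exists j.
by apply: nneseries_ge0 => k _ _; exact: ge0.
Qed.

End BoxVolume.
(* Distinct boxes are put at different multiples of a common bound for all
   side lengths, so that their projections are pairwise disjoint as well. *)
Lemma exists_compact_volume (R : realType) (n : nat)
    (l : nesubset n -> 'I_n -> R) :
  (forall B i, 0 <= l B i) ->
  exists T : set 'rV[R]_n, compact T /\
    forall A : nesubset n, volume (val A) (coord_proj (val A) @` T) =
      (\sum_(B : nesubset n | val A \subset val B) \prod_(i in val A) l B i)%:E.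
Proof.
move=> l0.
pose M := 1 + \sum_(B : nesubset n) \sum_i l B i.
have lM B i : l B i < M.
  apply: le_lt_trans (_ : \sum_B \sum_i l B i < M); last by rewrite ltrDr ltr01.
  rewrite (bigD1 B) //= (bigD1 i) //= -addrA lerDl addr_ge0 ?sumr_ge0 //.
  by move=> *; rewrite sumr_ge0.
have M0 : 0 <= M by rewrite addr_ge0 // sumr_ge0 // => *; rewrite sumr_ge0.
pose o (B : nesubset n) : R := (enum_rank B)%:R * M.
(* Sides outside [B] are degenerate, so the projection to Span(A) has volume 0 unless [A] is
   contained in [B]. *)
pose lo (B : nesubset n) : 'rV[R]_n := \row_i if i \in val B then o B else 0.
pose hi (B : nesubset n) : 'rV[R]_n :=
  \row_i if i \in val B then o B + l B i else 0.
have lohi B i : lo B 0 i <= hi B 0 i.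
  by rewrite !mxE; case: ifP => // _; rewrite lerDl.
pose box (B : nesubset n) := coord_box [set: 'I_n] (lo B) (hi B).
exists (\bigcup_B box B); split.
  have -> : \bigcup_B box B = \big[setU/set0]_(B in nesubset n) box B.
    by rewrite -bigcup_pred; apply: eq_bigcupl; split=> B.
  by apply: bigsetU_compact => B _; exact: compact_coord_box.
move=> A.
have volB B : box_volume (val A) (lo B) (hi B) =
    if val A \subset val B then \prod_(i in val A) l B i else 0.
  rewrite /box_volume; case: ifPn.
    move=> /fintype.subsetP AB; apply: eq_bigr => i /AB iB.
    by rewrite !mxE iB addrAC subrr add0r.
  case/fintype.subsetPn=> i iA iB.
  by rewrite (bigD1 i) //= !mxE (negPf iB) subrr mul0r.
have projT : coord_proj (val A) @` (\bigcup_B box B) =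
    \bigcup_B coord_box (val A) (lo B) (hi B).
  rewrite image_bigcup; apply: eq_bigcupr => B _.
  exact: coord_proj_box.
rewrite projT; apply/eqP; rewrite eq_le; apply/andP; split.
  rewrite [X in (_ <= X%:E)%E](_ : _ = \sum_B box_volume (val A) (lo B) (hi B)).
    exact: volume_le_sum (valP A) _ _.
  by rewrite big_mkcond; apply: eq_bigr => B _; rewrite volB.
rewrite (eq_bigr (fun B => box_volume (val A) (lo B) (hi B))); last first.
  by move=> B AB; rewrite volB AB.
apply: sum_le_volume => // [B _ x Bx|B C x]; first by exists B.
move=> /fintype.subsetP AB /fintype.subsetP AC [_ xB] [_ xC].
case/set0Pn: (valP A) => i iA; apply: enum_rank_inj; apply: val_inj.
have := xB i iA; have := xC i iA; rewrite !mxE AB // AC // /o.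
(* Since [l E i < M], the interval of [E] ends before the offset of any set of larger rank. *)
have near (D E : nesubset n) t : (enum_rank D)%:R * M <= t ->
    t <= (enum_rank E)%:R * M + l E i -> (enum_rank D <= enum_rank E)%N.
  move=> Dt tE; rewrite leqNgt; apply/negP => ED.
  have : (enum_rank E).+1%:R * M <= (enum_rank D)%:R * M.
    by rewrite ler_wpM2r // ler_nat.
  have := lM E i; rewrite -natr1 mulrDl mul1r; lra.
move=> /andP[c1 c2] /andP[b1 b2]; apply/eqP; rewrite eqn_leq.
by rewrite (near _ _ _ b1 c2) (near _ _ _ c1 b2).
Qed.

(** * Scaling factors, by recursion from large sets to small ones *)

(** Iterating [F] from a constant function, the value at [C] is stable after [k] rounds once
    [n < #|C| + k], because it depends only on strictly larger sets. *)
Lemma exists_top_down_fixpoint (n : nat) (X : Type) (x0 : X)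
    (F : (nesubset n -> X) -> nesubset n -> X) :
  (forall (w w' : nesubset n -> X) (C : nesubset n),
    (forall B : nesubset n, val C \proper val B -> w B = w' B) ->
    F w C = F w' C) ->
  exists w, forall C, w C = F w C.
Proof.
move=> Floc; pose W k := iter k F (fun=> x0).
have stable k (C : nesubset n) : (n < #|val C| + k)%N -> W k C = W k.+1 C.
  elim: k C => [|k IH] C.
    by rewrite addn0 ltnNge -[n in leqRHS]card_ord max_card.
  move=> nC; apply: Floc => B /proper_card CB; apply: IH.
  by apply: leq_trans nC _; rewrite -addSnnS leq_add2r.
by exists (W n.+1) => C; apply: stable; rewrite addnS ltnS leq_addl.
Qed.

Lemma proper_nesubset_ind (n : nat) (P : nesubset n -> Prop) :
  (forall C : nesubset n,
    (forall B : nesubset n, val C \proper val B -> P B) -> P C) ->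
  forall C, P C.
Proof.
move=> H C; have [m] := ubnP (n - #|val C|); elim: m => // m IH in C *.
move=> Cm; apply: H => B /proper_card CB; apply: IH.
have := max_card (val B); rewrite card_ord; lia.
Qed.

(** [w B] rescales the side [p B] of the box of [B], and [f C B] is the volume of the unscaled
    projection of that box to Span(C) relative to the target for [C]. The equation at [C] prescribes
    the total volume, divided by the target. *)
Lemma exists_weights (R : realFieldType) (n : nat)
    (f : nesubset n -> nesubset n -> R) (p : nesubset n -> 'I_n) :
  (forall C B : nesubset n, val C \proper val B ->
    0 <= f C B <= #|nesubset n|%:R^-1) ->
  exists w : nesubset n -> R, (forall C, 0 <= w C) /\ forall C,
    w C + \sum_(B : nesubset n | val C \proper val B)
            f C B * (if p B \in val C then w B else 1) = 1.
Proof.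
move=> f01.
pose F (w : nesubset n -> R) (C : nesubset n) : R :=
  1 - \sum_(B : nesubset n | val C \proper val B)
        f C B * (if p B \in val C then w B else 1).
have [w wE] : exists w, forall C, w C = F w C.
  apply: (@exists_top_down_fixpoint n R 0) => w w' C ww'.
  by congr (1 - _); apply: eq_bigr => B CB; rewrite ww'.
exists w; split=> [C|C]; last by rewrite {1}wE subrK.
(* The bounds are proved together: [w B <= 1] on larger sets keeps the subtracted sum at most 1,
   whence [0 <= w C]. *)
suff /andP[] : 0 <= w C <= 1 by [].
elim/proper_nesubset_ind: C => C IH.
have t01 (B : nesubset n) : val C \proper val B ->
    0 <= (if p B \in val C then w B else 1) <= 1.
  by move=> CB; case: ifP => _; [exact: IH|rewrite ler01 lexx].
rewrite wE; apply/andP; split; last first.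
  rewrite gerBl sumr_ge0 // => B CB.
  by case/andP: (f01 _ _ CB) (t01 _ CB) => f0 _ /andP[t0 _]; exact: mulr_ge0.
rewrite subr_ge0.
apply: (@le_trans _ _ (\sum_(B : nesubset n) #|nesubset n|%:R^-1)).
  rewrite big_mkcond; apply: ler_sum => B _; case: ifP => CB.
    case/andP: (f01 _ _ CB) (t01 _ CB) => f0 f1 /andP[t0 t1].
    by rewrite -[leRHS]mulr1 ler_pM.
  by rewrite invr_ge0 ler0n.
rewrite sumr_const -[_ *+ _]mulr_natl mulfV // pnatr_eq0 -lt0n.
by apply/card_gt0P; exists C.
Qed.

(** * Choice of the threshold and assembly of the boxes *)

Theorem lemma12 (R : realType) (n : nat) (hn : (0 < n)%N)
    (v : coord_vector R n) (hv : BT v)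
    (hstrict : forall (Y : nesubset n) (k : nat) (c : seq (nesubset n)),
       kuniform_cover k Y c -> irreducible_cover Y c -> c <> [:: Y] ->
       k%:R * v Y < \sum_(Z <- c) v Z) :
  exists lambda0 : R, 0 < lambda0 /\
    forall lambda : R, lambda0 <= lambda -> psi (lambda *: v).
Proof.
have /choice[y Hy] := fun Y => exists_box_exponents (uniform_cover_lt (@hstrict Y)).
have /choice[p Hp] : forall Y : nesubset n, exists i, i \in val Y.
  by move=> Y; case/set0Pn: (valP Y) => i; exists i.
pose N : R := #|nesubset n|%:R.
pose gap (C B : nesubset n) := v C - \sum_(i in val C) y B i.
have gap_gt0 (C B : nesubset n) : val C \proper val B -> 0 < gap C B.
  by case: (Hy B) => _ H /H; rewrite subr_gt0.
(* A sum serves in place of a maximum, and absolute values keep the terms of non-nested pairs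
   non-negative. Beyond this threshold [lambda * gap C B >= N] for nested pairs, so
   [expR (- (lambda * gap C B)) <= N^-1]. *)
pose lambda0 : R := 1 + \sum_C \sum_B N / `|gap C B|.
have term_ge0 C B : 0 <= N / `|gap C B| by rewrite divr_ge0 ?ler0n.
exists lambda0; split.
  by rewrite ltr_wpDr // !sumr_ge0 // => C _; rewrite sumr_ge0.
move=> lambda lambda_ge.
have N_le (C B : nesubset n) : val C \proper val B -> N <= lambda * gap C B.
  move=> /gap_gt0 g0; rewrite -ler_pdivrMr // -[in leLHS](gtr0_norm g0).
  apply: le_trans lambda_ge.
  rewrite /lambda0 (bigD1 C) //=.
  rewrite [\sum_j N / `|gap C j|](bigD1 B) //= addrCA -addrA lerDl.
  by rewrite !addr_ge0 // !sumr_ge0 // => *; rewrite sumr_ge0.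
have [|w [w0 wE]] := @exists_weights R n (fun C B => expR (- (lambda * gap C B))) p.
  move=> C B CB; rewrite expR_ge0 expRN lef_pV2 ?posrE ?expR_gt0 //; last first.
    by rewrite ltr0n; apply/card_gt0P; exists C.
  apply: le_trans (N_le C B CB) _.
  by apply: le_trans (expR_ge1Dx _); rewrite lerDr ler01.
pose l B i := expR (lambda * y B i) * (if i == p B then w B else 1).
have prod_l (C B : nesubset n) : \prod_(i in val C) l B i =
    expR (lambda * \sum_(i in val C) y B i) * (if p B \in val C then w B else 1).
  rewrite big_split /= mulr_sumr expR_sum; congr (_ * _).
  rewrite -big_mkcondr; case: ifPn => pC.
    rewrite (big_pred1 (p B)) // => i.
    by rewrite /= andb_idl // => /eqP->.
  by rewrite big1 // => i /andP[iC /eqP ip]; rewrite -ip iC in pC.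
have [|T [cT volT]] := @exists_compact_volume R n l.
  by move=> B i; rewrite mulr_ge0 ?expR_ge0 //; case: ifP.
exists T; split=> // A; rewrite volT.
suff -> : \sum_(B : nesubset n | val A \subset val B) \prod_(i in val A) l B i =
    expR (lambda * v A).
  by rewrite lne_EFin ?expR_gt0 // expRK ffunE.
(* The box of [A] itself contributes [expR (lambda * v A) * w A]. Factoring [expR (lambda * v A)]
   out of the other terms leaves the weight equation at [A]. *)
rewrite (bigD1 A) //= prod_l Hp (Hy A).1.
rewrite -[RHS]mulr1 -[X in _ = _ * X](wE A) mulrDr; congr (_ + _).
rewrite mulr_sumr; apply: eq_big => [B|B /andP[AB _]].
  by rewrite finset.properEneq andbC eq_sym (inj_eq val_inj).
rewrite prod_l mulrA -expRD; congr (expR _ * _).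
by rewrite /gap; ring.
Qed.
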